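(* Let $R$ be a commutative ring with non-zero identity. If $\{I_i: i\in\Delta\}$ is a non-empty family of weakly $J$-ideals of $R$, then $\bigcap_{i\in\Delta} I_i$ is a weakly $J$-ideal of $R$.
   Context: $J(R)$ denotes the Jacobson radical of $R$. A proper ideal $I$ of $R$ is a weakly $J$-ideal if whenever $a,b\in R$ with $0\neq ab\in I$ and $a\notin J(R)$, then $b\in I$. *)

(* Defs.v *)
From mathcomp Require Export all_boot all_algebra.
From mathcomp Require Export boolp classical_sets.

Set Implicit Arguments.
Unset Strict Implicit.
Unset Printing Implicit Defensive.

Import GRing.Theory.
Local Open Scope ring_scope.
Local Open Scope classical_set_scope.

(* [idealr_closed] includes the condition that 1 does not belong to the ideal;
   ideals are arbitrary (not necessarily decidable) sets, hence the classical
   membership predicate [in I]. *)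
Definition is_proper_ideal (R : comNzRingType) (I : set R) : Prop :=
  idealr_closed [in I].

Definition is_maximal_ideal (R : comNzRingType) (M : set R) : Prop :=
  is_proper_ideal M /\
  forall N : set R, is_proper_ideal N -> M `<=` N -> N = M.

Definition jacobson_radical (R : comNzRingType) : set R :=
  \bigcap_(M in @is_maximal_ideal R) M.

Definition weakly_J_ideal (R : comNzRingType) (I : set R) : Prop :=
  is_proper_ideal I /\
  forall a b : R, a * b != 0 -> I (a * b) -> ~ jacobson_radical a -> I b.

(* Main.v *)
Require Import Defs.

Local Open Scope ring_scope.
Local Open Scope classical_set_scope.

(** The premises [a * b != 0] and [a] outside the Jacobson radical do not mention the ideal, and
    [a * b] in the intersection lies in every member, so each member yields [b] separately.
    Properness is [bigcap_proper_ideal]; [is_proper_idealP] trades the boolean [[in I]] for plain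
    membership so that it can be checked memberwise. *)

Lemma is_proper_idealP (R : comNzRingType) (I : set R) :
  is_proper_ideal I <->
  [/\ I 0, ~ I 1 & forall a u v, I u -> I v -> I (a * u + v)].
Proof.
split=> -[I0 I1 Ilin]; split.
- exact: set_mem I0.
- by move=> /mem_set I1'; move/negP: I1; apply.
- by move=> a u v /mem_set Iu /mem_set Iv; apply: set_mem; apply: Ilin.
- exact: mem_set I0.
- by apply/negP => /set_mem.
- by move=> a u v /set_mem Iu /set_mem Iv; apply: mem_set; apply: Ilin.
Qed.

Lemma bigcap_proper_ideal (R : comNzRingType) (T : Type) (D : set T)
    (I : T -> set R) :
  D !=set0 -> (forall i, D i -> is_proper_ideal (I i)) ->
  is_proper_ideal (\bigcap_(i in D) I i).
Proof.
move=> [i0 Di0] idealI; apply/is_proper_idealP; split.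
- by move=> i /idealI /is_proper_idealP[].
(* Nonemptiness enters here: the empty intersection is all of [R], whereas a single member [I i0]
   already excludes 1. *)
- by move/(_ i0 Di0); case/is_proper_idealP: (idealI i0 Di0).
- move=> a u v Iu Iv i Di; have /is_proper_idealP[_ _] := idealI i Di.
  by apply; [exact: Iu | exact: Iv].
Qed.

Theorem proposition4 (R : comNzRingType) (T : Type) (Delta : set T)
    (I : T -> set R) (Delta_nonempty : Delta !=set0)
    (weakly_J_I : forall i, Delta i -> weakly_J_ideal (I i)) :
  weakly_J_ideal (\bigcap_(i in Delta) I i).
Proof.
split; first by apply: bigcap_proper_ideal => // i /weakly_J_I[].
move=> a b ab0 Iab Ja i Di; have [_ wJ] := weakly_J_I i Di.
exact: wJ ab0 (Iab i Di) Ja.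
Qed.
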